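(* Let $A$ be a C*-algebra and $G$ be a residually finite group. If $\alpha:G\to\mathrm{Aut}(A)$ is an action such that $\dim_{\mathrm{Rok}}(\alpha)<\infty$, then $\alpha$ is pointwise outer.
   Context: All groups are countable and discrete. A group $G$ is residually finite if for each non-identity element $g\in G$ there is a subgroup $H$ of $G$ of finite index such that $g\notin H$. An automorphism $\alpha\in\mathrm{Aut}(A)$ is inner if there is a unitary $u\in\widetilde{A}$ (the unitization of $A$) with $\alpha(a)=uau^*$ for all $a\in A$, and outer if it is not inner. An action $\alpha:G\to\mathrm{Aut}(A)$ is pointwise outer if $\alpha_g$ is outer for each non-identity element $g\in G$. Elements $a,b$ of a C*-algebra are orthogonal, $a\perp b$, if $ab=ba=a^*b=b^*a=0$. A contractive completely positive (c.c.p.) map $\varphi$ between C*-algebras has order zero if $\varphi(a)\perp\varphi(b)$ whenever $a\perp b$. Central sequence algebra: $A_\infty:=\ell^\infty(\mathbb{N},A)/c_0(\mathbb{N},A)$, with $A$ embedded as constant sequences. For a C*-subalgebra $D\subset A$, $A_\infty\cap D'=\{x\in A_\infty: xd=dx\text{ for all }d\in D\}$, $\mathrm{Ann}(D,A_\infty)=\{x\in A_\infty: xd=dx=0\text{ for all }d\in D\}$, and $F(D,A):=(A_\infty\cap D')/\mathrm{Ann}(D,A_\infty)$, which is unital if $D$ is $\sigma$-unital. If $D$ is invariant under an action $\alpha$ of $G$ on $A$, $\widetilde{\alpha}_\infty$ denotes the induced action of $G$ on $F(D,A)$. Rokhlin dimension of an action $\alpha:G\to\mathrm{Aut}(A)$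 of a residually finite group $G$: for a subgroup $H\leq G$ of finite index, $\sigma^H$ is the action of $G$ on $C(G/H)$ given by $\sigma^H_t(f)(gH)=f(t^{-1}gH)$. $\dim_{\mathrm{Rok}}(\alpha,H)$ is the least integer $d$ such that for every separable $\alpha$-invariant C*-subalgebra $D\subset A$ there exist $(d+1)$ $G$-equivariant c.c.p. order zero maps $\varphi_0,\ldots,\varphi_d:(C(G/H),\sigma^H)\to(F(D,A),\widetilde{\alpha}_\infty)$ with $\sum_{\ell=0}^d\varphi_\ell(1_{C(G/H)})=1_{F(D,A)}$ (and $+\infty$ if no such $d$ exists). $\dim_{\mathrm{Rok}}(\alpha)=\sup_H\dim_{\mathrm{Rok}}(\alpha,H)$, the supremum over all finite index subgroups $H$ of $G$.
   Formalization: The C*-algebra A is assumed nonzero: for A = 0 and nontrivial G, F(D,A) = 0, so the Rokhlin dimension is 0 while every automorphism is the identity and hence inner. *)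

(* Defs.v *)
From HB Require Import structures.
From mathcomp Require Import all_boot all_order all_algebra.
From mathcomp Require Import all_classical all_reals all_analysis.
From mathcomp Require Import complex.

Set Implicit Arguments.
Unset Strict Implicit.
Unset Printing Implicit Defensive.

Import Order.TTheory GRing.Theory Num.Theory.
Import numFieldNormedType.Exports.

Local Open Scope classical_set_scope.
Local Open Scope quotient_scope.
Local Open Scope ring_scope.

(* Complex *-algebras, not necessarily unital *)
HB.mixin Record Lmodule_isStarAlgebra (K : numClosedFieldType) V
    of GRing.Lmodule K V := {
  smul : V -> V -> V;
  star : V -> V;
  smulA : associative smul;
  smulDl : left_distributive smul +%R;
  smulDr : right_distributive smul +%R;
  smulZl : forall (k : K) x y, smul (k *: x) y = k *: smul x y;
  smulZr : forall (k : K) x y, smul x (k *: y) = k *: smul x y;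
  starK : involutive star;
  starD : {morph star : x y / x + y};
  starZ : forall (k : K) x, star (k *: x) = k^* *: star x;
  starM : forall x y, star (smul x y) = smul (star y) (star x)
}.

#[short(type="starAlgType")]
HB.structure Definition StarAlgebra (K : numClosedFieldType) :=
  {V of GRing.Lmodule K V & Lmodule_isStarAlgebra K V}.

Notation "x ** y" := (smul x y) (at level 40, left associativity) : ring_scope.

Section StarAlgebraTheory.
Variables (K : numClosedFieldType) (V : starAlgType K).
Implicit Types x y : V.

Lemma smul0 x : x ** 0 = 0.
Proof. by rewrite -(scale0r 0) smulZr !scale0r. Qed.

Lemma mul0s x : 0 ** x = 0.
Proof. by rewrite -(scale0r 0) smulZl !scale0r. Qed.

Lemma smulBl x y z : (x - y) ** z = x ** z - y ** z.
Proof. by rewrite smulDl -scaleN1r smulZl scaleN1r. Qed.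

Lemma smulBr x y z : x ** (y - z) = x ** y - x ** z.
Proof. by rewrite smulDr -scaleN1r smulZr scaleN1r. Qed.

Lemma star0 : star (0 : V) = 0.
Proof. by rewrite -(scale0r 0) starZ conjC0 !scale0r. Qed.

Lemma starB x y : star (x - y) = star x - star y.
Proof. by rewrite starD -scaleN1r starZ rmorphN1 scaleN1r. Qed.

Definition is_identity (e : V) := forall x, e ** x = x /\ x ** e = x.

Definition orthogonal x y :=
  [/\ x ** y = 0, y ** x = 0, star x ** y = 0 & star y ** x = 0].

End StarAlgebraTheory.

Section StarAlgebraInstances.
Variable K : numClosedFieldType.

Lemma regular_starZ (k : K) (x : K^o) : (k *: x)^* = k^* *: (x^* : K^o).
Proof. exact: rmorphM. Qed.

Lemma regular_starM (x y : K^o) : (x * y)^* = y^* * x^*.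
Proof. by rewrite mulrC rmorphM. Qed.

Lemma regular_smulZr (k : K) (x y : K^o) : x * (k *: y) = k *: (x * y).
Proof. exact: mulrCA. Qed.

HB.instance Definition _ := @Lmodule_isStarAlgebra.Build K K^o
  (fun x y => x * y) (fun x => x^*)
  (@mulrA K) (@mulrDl K) (@mulrDr K) (fun k x y => esym (mulrA k x y))
  regular_smulZr (@conjCK K) (rmorphD _) regular_starZ regular_starM.

Section Functions.
Variables (T : Type) (V : starAlgType K).
Implicit Types f g h : T -> V.

Let fmul f g : T -> V := fun t => f t ** g t.
Let fstar f : T -> V := fun t => star (f t).

Let fmulA : associative fmul.
Proof. by move=> f g h; apply/funext => t; rewrite /fmul smulA. Qed.
Let fmulDl : left_distributive fmul +%R.
Proof. by move=> f g h; apply/funext => t; apply: smulDl. Qed.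
Let fmulDr : right_distributive fmul +%R.
Proof. by move=> f g h; apply/funext => t; apply: smulDr. Qed.
Let fmulZl (k : K) f g : fmul (k *: f) g = k *: fmul f g.
Proof. by apply/funext => t; apply: smulZl. Qed.
Let fmulZr (k : K) f g : fmul f (k *: g) = k *: fmul f g.
Proof. by apply/funext => t; apply: smulZr. Qed.
Let fstarK : involutive fstar.
Proof. by move=> f; apply/funext => t; apply: starK. Qed.
Let fstarD : {morph fstar : f g / f + g}.
Proof. by move=> f g; apply/funext => t; apply: starD. Qed.
Let fstarZ (k : K) f : fstar (k *: f) = k^* *: fstar f.
Proof. by apply/funext => t; apply: starZ. Qed.
Let fstarM f g : fstar (fmul f g) = fmul (fstar g) (fstar f).
Proof. by apply/funext => t; apply: starM. Qed.

HB.instance Definition _ := @Lmodule_isStarAlgebra.Build K (T -> V) fmul fstar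
  fmulA fmulDl fmulDr fmulZl fmulZr fstarK fstarD fstarZ fstarM.

End Functions.

Definition unitization (V : starAlgType K) : Type := (V * K^o)%type.

Section Unitization.
Variable V : starAlgType K.
Local Notation U := (unitization V).

HB.instance Definition _ := GRing.Lmodule.on U.

Let umul (x y : U) : U :=
  (x.1 ** y.1 + y.2 *: x.1 + x.2 *: y.1, x.2 * y.2).
Let ustar (x : U) : U := (star x.1, x.2^*).

Let umulA : associative umul.
Proof.
move=> [x a] [y b] [z c]; rewrite /umul/=; congr pair; last exact: mulrA.
rewrite !(smulDl, smulDr, smulZl, smulZr, scalerDr, scalerA) smulA.
by rewrite !addrA [RHS](ACl (1*4*2*5*3*6*7))/= [c * b]mulrC [c * a]mulrC.
Qed.
Let umulDl : left_distributive umul +%R.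
Proof.
move=> [x a] [y b] [z c]; rewrite /umul/=; congr pair; last exact: mulrDl.
by rewrite smulDl scalerDr scalerDl !addrA; rewrite (ACl (1*3*5*2*4*6))/=.
Qed.
Let umulDr : right_distributive umul +%R.
Proof.
move=> [x a] [y b] [z c]; rewrite /umul/=; congr pair; last exact: mulrDr.
by rewrite smulDr scalerDr scalerDl !addrA; rewrite (ACl (1*3*5*2*4*6))/=.
Qed.
Let umulZl (k : K) (x y : U) : umul (k *: x) y = k *: umul x y.
Proof.
rewrite /umul/=; congr pair; last exact: esym (mulrA _ _ _).
by rewrite smulZl !scalerDr !scalerA [y.2 * k]mulrC.
Qed.
Let umulZr (k : K) (x y : U) : umul x (k *: y) = k *: umul x y.
Proof.
rewrite /umul/=; congr pair; last exact: mulrCA.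
by rewrite smulZr !scalerDr !scalerA [x.2 * k]mulrC.
Qed.
Let ustarK : involutive ustar.
Proof. by move=> [x a]; rewrite /ustar/= starK conjCK. Qed.
Let ustarD : {morph ustar : x y / x + y}.
Proof. by move=> [x a] [y b]; rewrite /ustar/= starD rmorphD. Qed.
Let ustarZ (k : K) (x : U) : ustar (k *: x) = k^* *: ustar x.
Proof. by case: x => x a; rewrite /ustar/= starZ rmorphM. Qed.
Let ustarM (x y : U) : ustar (umul x y) = umul (ustar y) (ustar x).
Proof.
case: x y => [x a] [y b]; rewrite /ustar /umul/=; congr pair.
  by rewrite !starD !starZ starM -!addrA [X in _ + X]addrC.
by rewrite mulrC rmorphM.
Qed.

HB.instance Definition _ := @Lmodule_isStarAlgebra.Build K U umul ustar
  umulA umulDl umulDr umulZl umulZr ustarK ustarD ustarZ ustarM.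

End Unitization.

End StarAlgebraInstances.

Section Inner.
Variables (K : numClosedFieldType) (A : starAlgType K).

Definition to_unitization (a : A) : unitization A := (a, 0).
Definition one_unitization : unitization A := (0, 1).

Definition unitary (u : unitization A) :=
  star u ** u = one_unitization /\ u ** star u = one_unitization.

(* When A already has an identity, the unitaries of A and those of A (+) C
   implement the same automorphisms of A. *)
Definition inner (f : A -> A) := exists2 u : unitization A, unitary u &
  forall a, to_unitization (f a) = u ** to_unitization a ** star u.

Record star_automorphism (f : A -> A) : Prop := {
  star_aut_linear : linear f;
  star_aut_mul : {morph f : x y / x ** y};
  star_aut_star : {morph f : x / star x};
  star_aut_bij : bijective f
}.

End Inner.

HB.mixin Record isStarMulClosed (K : numClosedFieldType) (V : starAlgType K)
    (S : {pred V}) := {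
  rpred_smul : {in S &, forall x y, x ** y \in S};
  rpred_star : {in S, forall x, star x \in S}
}.

#[short(type="starSubalg")]
HB.structure Definition StarSubalg (K : numClosedFieldType)
  (V : starAlgType K) :=
  {S of GRing.AddClosed V S & GRing.isScaleClosed K V S
      & isStarMulClosed K V S}.

HB.mixin Record isStarIdeal (K : numClosedFieldType) (V : starAlgType K)
    (S : {pred V}) := {
  rpred_smull : forall x y, y \in S -> x ** y \in S;
  rpred_smulr : forall x y, x \in S -> x ** y \in S;
  rpred_star_ideal : {in S, forall x, star x \in S}
}.

#[short(type="starIdeal")]
HB.structure Definition StarIdeal (K : numClosedFieldType)
  (V : starAlgType K) :=
  {S of GRing.AddClosed V S & GRing.isScaleClosed K V S
      & isStarIdeal K V S}.

Section SubStarAlgebra.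
Variables (K : numClosedFieldType) (V : starAlgType K) (S : starSubalg V).

Definition sub_star : Type := {x : V | x \in S}.

HB.instance Definition _ := SubChoice.on sub_star.
HB.instance Definition _ := [SubChoice_isSubLmodule of sub_star by <:].

Let mul (x y : sub_star) : sub_star :=
  exist _ (val x ** val y) (rpred_smul _ _ (valP x) (valP y)).
Let st (x : sub_star) : sub_star :=
  exist _ (star (val x)) (rpred_star _ (valP x)).

Let mulA : associative mul.
Proof. by move=> x y z; apply: val_inj; apply: smulA. Qed.
Let mulDl : left_distributive mul +%R.
Proof. by move=> x y z; apply: val_inj; apply: smulDl. Qed.
Let mulDr : right_distributive mul +%R.
Proof. by move=> x y z; apply: val_inj; apply: smulDr. Qed.
Let mulZl (k : K) x y : mul (k *: x) y = k *: mul x y.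
Proof. by apply: val_inj; apply: smulZl. Qed.
Let mulZr (k : K) x y : mul x (k *: y) = k *: mul x y.
Proof. by apply: val_inj; apply: smulZr. Qed.
Let stK : involutive st.
Proof. by move=> x; apply: val_inj; apply: starK. Qed.
Let stD : {morph st : x y / x + y}.
Proof. by move=> x y; apply: val_inj; apply: starD. Qed.
Let stZ (k : K) x : st (k *: x) = k^* *: st x.
Proof. by apply: val_inj; apply: starZ. Qed.
Let stM x y : st (mul x y) = mul (st y) (st x).
Proof. by apply: val_inj; apply: starM. Qed.

HB.instance Definition _ := @Lmodule_isStarAlgebra.Build K sub_star mul st
  mulA mulDl mulDr mulZl mulZr stK stD stZ stM.

(* The restriction of f to S; it is only meaningful when f maps S to S. *)
Definition sub_map (f : V -> V) (x : sub_star) : sub_star :=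
  insubd 0 (f (val x)).

Lemma val_sub_map f x : f (val x) \in S -> val (sub_map f x) = f (val x).
Proof. by move=> fx; rewrite val_insubd fx. Qed.

End SubStarAlgebra.

Section QuotStarAlgebra.
Variables (K : numClosedFieldType) (V : starAlgType K) (I : starIdeal V).

(* I as an instance of zmodClosed, as {ideal_quot _} requires *)
Definition ideal_zmod : {pred V} := [pred x | x \in I].

Fact ideal_zmod_closed : zmod_closed ideal_zmod.
Proof.
split=> [|x y xI yI]; rewrite inE ?rpred0// -scaleN1r.
by rewrite rpredD// rpredZ.
Qed.

HB.instance Definition _ := GRing.isZmodClosed.Build V ideal_zmod
  ideal_zmod_closed.

Definition quot_star : Type := {ideal_quot ideal_zmod}.
Local Notation Q := quot_star.

HB.instance Definition _ := GRing.Zmodule.on Q.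

Definition quot_pi (x : V) : Q := \pi_{ideal_quot ideal_zmod} x.
Definition quot_repr (z : Q) : V := repr (z : {ideal_quot ideal_zmod}).

Lemma quot_reprK : cancel quot_repr quot_pi.
Proof. exact: (@reprK _ {ideal_quot ideal_zmod}). Qed.

Lemma quot_piP x y : quot_pi x = quot_pi y <-> x - y \in I.
Proof.
rewrite -[x - y \in I]/(x - y \in ideal_zmod) Quotient.idealrBE.
by split=> [/eqP|/eqP].
Qed.

Lemma quot_piD x y : quot_pi (x + y) = quot_pi x + quot_pi y.
Proof. exact: (@pi_addr _ _ _ _ _ {ideal_quot ideal_zmod}). Qed.

Lemma quot_repr_pi x : quot_repr (quot_pi x) - x \in I.
Proof. by apply/quot_piP; rewrite quot_reprK. Qed.

Let scale (k : K) (z : Q) : Q := quot_pi (k *: quot_repr z).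
Let mul (z w : Q) : Q := quot_pi (quot_repr z ** quot_repr w).
Let st (z : Q) : Q := quot_pi (star (quot_repr z)).

Let piZ k x : scale k (quot_pi x) = quot_pi (k *: x).
Proof. by apply/quot_piP; rewrite -scalerBr rpredZ// quot_repr_pi. Qed.

Let piM x y : mul (quot_pi x) (quot_pi y) = quot_pi (x ** y).
Proof.
apply/quot_piP; set x' := quot_repr _; set y' := quot_repr _.
rewrite -[x' ** y'](subrK (x ** y')) -addrA -smulBl -smulBr.
by apply: rpredD; [apply: rpred_smulr|apply: rpred_smull]; apply: quot_repr_pi.
Qed.

Let piS x : st (quot_pi x) = quot_pi (star x).
Proof. by apply/quot_piP; rewrite -starB rpred_star_ideal// quot_repr_pi. Qed.

Let piE := (piZ, piM, piS, quot_piD).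

Let quotW (P : Q -> Prop) : (forall x, P (quot_pi x)) -> forall z, P z.
Proof. by move=> h z; rewrite -(quot_reprK z). Qed.

Let scaleA k l z : scale k (scale l z) = scale (k * l) z.
Proof. by elim/quotW: z => x; rewrite !piE scalerA. Qed.
Let scale1 : left_id 1 scale.
Proof. by elim/quotW => x; rewrite !piE scale1r. Qed.
Let scaleDr : right_distributive scale +%R.
Proof.
by move=> k; elim/quotW => x; elim/quotW => y;
   rewrite -quot_piD !piE scalerDr quot_piD.
Qed.
Let scaleDl z : {morph scale^~ z : k l / k + l}.
Proof. by move=> k l; elim/quotW: z => x; rewrite !piE scalerDl quot_piD. Qed.

HB.instance Definition _ := GRing.Zmodule_isLmodule.Build K Q
  scaleA scale1 scaleDr scaleDl.

Let mulA : associative mul.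
Proof.
elim/quotW => x; elim/quotW => y; elim/quotW => z.
by rewrite !piE smulA.
Qed.
Let mulDl : left_distributive mul +%R.
Proof.
elim/quotW => x; elim/quotW => y; elim/quotW => z.
by rewrite -quot_piD !piM smulDl quot_piD.
Qed.
Let mulDr : right_distributive mul +%R.
Proof.
elim/quotW => x; elim/quotW => y; elim/quotW => z.
by rewrite -quot_piD !piM smulDr quot_piD.
Qed.
Let mulZl (k : K) z w : mul (k *: z) w = k *: mul z w.
Proof.
elim/quotW: z => x; elim/quotW: w => y.
by rewrite [_ *: _]piZ [RHS]/GRing.scale/= !piM piZ smulZl.
Qed.
Let mulZr (k : K) z w : mul z (k *: w) = k *: mul z w.
Proof.
elim/quotW: z => x; elim/quotW: w => y.
by rewrite [_ *: _]piZ [RHS]/GRing.scale/= !piM piZ smulZr.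
Qed.
Let stK : involutive st.
Proof. by elim/quotW => x; rewrite !piS starK. Qed.
Let stD : {morph st : z w / z + w}.
Proof.
by elim/quotW => x; elim/quotW => y; rewrite -quot_piD !piS starD quot_piD.
Qed.
Let stZ (k : K) z : st (k *: z) = k^* *: st z.
Proof.
elim/quotW: z => x.
by rewrite [_ *: _]piZ [RHS]/GRing.scale/= !piS piZ starZ.
Qed.
Let stM z w : st (mul z w) = mul (st w) (st z).
Proof.
by elim/quotW: z => x; elim/quotW: w => y; rewrite piM !piS piM starM.
Qed.

HB.instance Definition _ := @Lmodule_isStarAlgebra.Build K Q mul st
  mulA mulDl mulDr mulZl mulZr stK stD stZ stM.

Lemma quot_piZ k x : quot_pi (k *: x) = k *: quot_pi x.
Proof. exact: esym (piZ k x). Qed.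

Lemma quot_piM x y : quot_pi (x ** y) = quot_pi x ** quot_pi y.
Proof. exact: esym (piM x y). Qed.

Lemma quot_pi_star x : quot_pi (star x) = star (quot_pi x).
Proof. exact: esym (piS x). Qed.

(* The map induced by f on the quotient; it is only meaningful when f is
   additive and maps I to I, and is then characterized by quot_map_pi. *)
Definition quot_map (f : V -> V) (z : Q) : Q := quot_pi (f (quot_repr z)).

Lemma quot_map_pi (f : V -> V) x :
  {morph f : x y / x - y} -> {in I, forall y, f y \in I} ->
  quot_map f (quot_pi x) = quot_pi (f x).
Proof. by move=> fB fI; apply/quot_piP; rewrite -fB fI// quot_repr_pi. Qed.

(* The quotient norm, where N is the norm of V *)
Definition quot_norm (R : realType) (N : V -> R) (z : Q) : R :=
  inf [set N x | x in [set x | quot_pi x = z]].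

End QuotStarAlgebra.

Section OrderZero.
Variables (K : numClosedFieldType) (V W : starAlgType K).

Definition mx_smul (U : starAlgType K) n (M N : 'M[U]_n) : 'M[U]_n :=
  \matrix_(i, j) \sum_k M i k ** N k j.

Definition mx_star (U : starAlgType K) n (M : 'M[U]_n) : 'M[U]_n :=
  \matrix_(i, j) star (M j i).

(* Positive elements of M_n(U) are those of the form N^* N. *)
Definition mx_positive (U : starAlgType K) n (M : 'M[U]_n) :=
  exists N : 'M[U]_n, M = mx_smul (mx_star N) N.

Definition completely_positive (f : V -> W) :=
  forall n (M : 'M[V]_n), mx_positive M -> mx_positive (map_mx f M).

Definition contractive (R : realType) (NV : V -> R) (NW : W -> R)
  (f : V -> W) := forall x, NW (f x) <= NV x.

Definition order_zero (f : V -> W) :=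
  forall x y, orthogonal x y -> orthogonal (f x) (f y).

End OrderZero.

HB.mixin Record isCStarAlgebra (R : realType) A
    of CompleteNormedModule R[i] A & StarAlgebra R[i] A := {
  ler_norm_smul : forall x y : A, `|x ** y| <= `|x| * `|y|;
  norm_star_smul : forall x : A, `|star x ** x| = `|x| ^+ 2
}.

#[short(type="cstarAlgType")]
HB.structure Definition CStarAlgebra (R : realType) :=
  {A of CompleteNormedModule R[i] A & StarAlgebra R[i] A
      & isCStarAlgebra R A}.

Section SupNorm.
Variable R : realType.

(* Norms of normed R[i]-modules take values in R[i]. *)
Definition supnorm (T : Type) (V : normedModType R[i]) (f : T -> V) : R :=
  sup (range (fun t => complex.Re `|f t|)).

End SupNorm.

Section CentralSequences.
Variables (R : realType) (A : cstarAlgType R).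

Lemma norm_star (x : A) : `|star x| = `|x|.
Proof.
have le (y : A) : `|y| <= `|star y|.
  have [->|y0] := eqVneq y 0; first by rewrite normr0.
  have yp : 0 < `|y| by rewrite normr_gt0.
  by rewrite -(ler_pM2r yp) -expr2 -norm_star_smul ler_norm_smul.
by apply/le_anti; rewrite le (le_trans (le _)) ?starK.
Qed.

Definition linf_pred : {pred nat -> A} :=
  [pred x : nat -> A | `[< exists M : R[i], forall n, `|x n| <= M >]].

Fact linf_add : addr_closed linf_pred.
Proof.
split=> [|x y /asboolP[M xM] /asboolP[N yN]]; apply/asboolP.
  by exists 0 => n; rewrite normr0.
by exists (M + N) => n; rewrite (le_trans (ler_normD _ _))// lerD.
Qed.

Fact linf_scale : scaler_closed linf_pred.
Proof.
move=> k x /asboolP[M xM]; apply/asboolP; exists (`|k| * M) => n.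
by rewrite normrZ ler_wpM2l.
Qed.

Fact linf_smul : {in linf_pred &, forall x y, x ** y \in linf_pred}.
Proof.
move=> x y /asboolP[M xM] /asboolP[N yN]; apply/asboolP; exists (M * N) => n.
by rewrite (le_trans (ler_norm_smul _ _))// ler_pM.
Qed.

Fact linf_star : {in linf_pred, forall x, star x \in linf_pred}.
Proof.
move=> x /asboolP[M xM]; apply/asboolP; exists M => n.
by rewrite [star x n]/(star (x n)) norm_star.
Qed.

HB.instance Definition _ :=
  GRing.isAddClosed.Build (nat -> A) linf_pred linf_add.
HB.instance Definition _ :=
  GRing.isScaleClosed.Build R[i] (nat -> A) linf_pred linf_scale.
HB.instance Definition _ :=
  isStarMulClosed.Build R[i] (nat -> A) linf_pred linf_smul linf_star.

Definition linf : Type := sub_star linf_pred.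
HB.instance Definition _ := StarAlgebra.on linf.

Lemma linfP (x : linf) : exists M : R[i], forall n, `|val x n| <= M.
Proof. exact/asboolP/(valP x). Qed.

Definition linf_norm (x : linf) : R := supnorm (val x).

Definition c0_pred : {pred linf} :=
  [pred x : linf | `[< val x @ \oo --> (0 : A) >]].

Fact c0_add : addr_closed c0_pred.
Proof.
split=> [|x y /asboolP x0 /asboolP y0]; apply/asboolP; first exact: cvg_cst.
by rewrite -[0]addr0; apply: cvgD.
Qed.

Fact c0_scale : scaler_closed c0_pred.
Proof.
move=> k x /asboolP x0; apply/asboolP; rewrite -[0](scaler0 _ k).
exact: cvgZr.
Qed.

Lemma c0_dominated (M : R[i]) (x y : nat -> A) :
  (forall n, `|y n| <= M * `|x n|) -> x @ \oo --> (0 : A) ->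
  y @ \oo --> (0 : A).
Proof.
move=> yx /cvgr0Pnorm_lt x0; apply/cvgr0Pnorm_lt => e e0.
have M0 : 0 < `|M| + 1 by rewrite ltr_wpDl.
have [N _ xN] := x0 _ (divr_gt0 e0 M0); exists N => // n /xN/=.
rewrite ltr_pdivlMr// mulrC; apply: le_lt_trans.
have Mx0 : 0 <= M * `|x n| by rewrite (le_trans _ (yx n)).
rewrite (le_trans (yx n))// -(ger0_norm Mx0) normrM normr_id.
by rewrite ler_wpM2r// lerDl.
Qed.

Fact c0_smull (x y : linf) : y \in c0_pred -> x ** y \in c0_pred.
Proof.
move=> /asboolP y0; apply/asboolP; have [M xM] := linfP x.
apply: (c0_dominated (M := M)) y0 => n.
by rewrite (le_trans (ler_norm_smul _ _))// ler_wpM2r.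
Qed.

Fact c0_smulr (x y : linf) : x \in c0_pred -> x ** y \in c0_pred.
Proof.
move=> /asboolP x0; apply/asboolP; have [M yM] := linfP y.
apply: (c0_dominated (M := M)) x0 => n.
by rewrite (le_trans (ler_norm_smul _ _))// mulrC ler_wpM2r.
Qed.

Fact c0_star : {in c0_pred, forall x, star x \in c0_pred}.
Proof.
move=> x /asboolP x0; apply/asboolP.
by apply: (c0_dominated (M := 1)) x0 => n; rewrite mul1r norm_star.
Qed.

HB.instance Definition _ := GRing.isAddClosed.Build linf c0_pred c0_add.
HB.instance Definition _ :=
  GRing.isScaleClosed.Build R[i] linf c0_pred c0_scale.
HB.instance Definition _ :=
  isStarIdeal.Build R[i] linf c0_pred c0_smull c0_smulr c0_star.

(* A_oo = l^oo(N, A) / c_0(N, A) *)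
Definition ainf : Type := quot_star c0_pred.
HB.instance Definition _ := StarAlgebra.on ainf.

Definition ainf_norm : ainf -> R := quot_norm (I := c0_pred) linf_norm.

Fact cst_linf (a : A) : (cst a : nat -> A) \in linf_pred.
Proof. by apply/asboolP; exists `|a|. Qed.

Definition to_ainf (a : A) : ainf :=
  quot_pi c0_pred (exist _ (cst a) (cst_linf a)).

Lemma to_ainf_star a : to_ainf (star a) = star (to_ainf a).
Proof. by rewrite -quot_pi_star; congr quot_pi; apply: val_inj. Qed.

Section RelativeCommutant.
Variable D : starSubalg A.

Definition commutant_pred : {pred ainf} :=
  [pred x : ainf | `[< {in D, forall d, x ** to_ainf d = to_ainf d ** x} >]].

Fact commutant_add : addr_closed commutant_pred.
Proof.
split=> [|x y /asboolP xD /asboolP yD]; apply/asboolP => d dD.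
  by rewrite smul0 mul0s.
by rewrite smulDl smulDr xD ?yD.
Qed.

Fact commutant_scale : scaler_closed commutant_pred.
Proof.
move=> k x /asboolP xD; apply/asboolP => d dD.
by rewrite smulZl smulZr xD.
Qed.

Fact commutant_smul :
  {in commutant_pred &, forall x y, x ** y \in commutant_pred}.
Proof.
move=> x y /asboolP xD /asboolP yD; apply/asboolP => d dD.
by rewrite -smulA yD// !smulA xD.
Qed.

Fact commutant_star :
  {in commutant_pred, forall x, star x \in commutant_pred}.
Proof.
move=> x /asboolP xD; apply/asboolP => d dD.
have /(congr1 star) := xD _ (rpred_star _ dD).
by rewrite !starM -!to_ainf_star starK.
Qed.

HB.instance Definition _ :=
  GRing.isAddClosed.Build ainf commutant_pred commutant_add.
HB.instance Definition _ :=
  GRing.isScaleClosed.Build R[i] ainf commutant_pred commutant_scale.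
HB.instance Definition _ := isStarMulClosed.Build R[i] ainf commutant_pred
  commutant_smul commutant_star.

(* A_oo `&` D' *)
Definition commutant : Type := sub_star commutant_pred.
HB.instance Definition _ := StarAlgebra.on commutant.

Definition ann_pred : {pred commutant} :=
  [pred x : commutant | `[< {in D, forall d,
     val x ** to_ainf d = 0 /\ to_ainf d ** val x = 0} >]].

Fact ann_add : addr_closed ann_pred.
Proof.
split=> [|x y /asboolP xD /asboolP yD]; apply/asboolP => d dD.
  by rewrite smul0 mul0s.
have [[x1 x2] [y1 y2]] := (xD d dD, yD d dD).
by rewrite [val _]/(val x + val y) smulDl smulDr x1 x2 y1 y2 addr0.
Qed.

Fact ann_scale : scaler_closed ann_pred.
Proof.
move=> k x /asboolP xD; apply/asboolP => d dD; have [x1 x2] := xD d dD.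
by rewrite [val _]/(k *: val x) smulZl smulZr x1 x2 scaler0.
Qed.

Fact ann_smull (x y : commutant) : y \in ann_pred -> x ** y \in ann_pred.
Proof.
move=> /asboolP yD; apply/asboolP => d dD; have [y1 y2] := yD d dD.
rewrite [val _]/(val x ** val y) -smulA y1 smul0 smulA.
by rewrite -(asboolP _ (valP x))// -smulA y2 smul0.
Qed.

Fact ann_smulr (x y : commutant) : x \in ann_pred -> x ** y \in ann_pred.
Proof.
move=> /asboolP xD; apply/asboolP => d dD; have [x1 x2] := xD d dD.
rewrite [val _]/(val x ** val y) smulA x2 mul0s -smulA.
by rewrite (asboolP _ (valP y))// smulA x1 mul0s.
Qed.

Fact ann_star : {in ann_pred, forall x, star x \in ann_pred}.
Proof.
move=> x /asboolP xD; apply/asboolP => d dD.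
have [x1 x2] := xD _ (rpred_star _ dD).
rewrite [val _]/(star (val x)) -[d]starK to_ainf_star -!starM.
by rewrite x1 x2 star0.
Qed.

HB.instance Definition _ := GRing.isAddClosed.Build commutant ann_pred ann_add.
HB.instance Definition _ :=
  GRing.isScaleClosed.Build R[i] commutant ann_pred ann_scale.
HB.instance Definition _ :=
  isStarIdeal.Build R[i] commutant ann_pred ann_smull ann_smulr ann_star.

(* F(D, A) = (A_oo `&` D') / Ann(D, A_oo) *)
Definition central_seq : Type := quot_star ann_pred.
HB.instance Definition _ := StarAlgebra.on central_seq.

Definition central_seq_norm : central_seq -> R :=
  quot_norm (I := ann_pred) (fun x : commutant => ainf_norm (val x)).

End RelativeCommutant.

(* The maps induced by f on A_oo and on F(D, A). They are meaningful because
   *-automorphisms are isometric, so preserve l^oo(N, A) and c_0(N, A), and D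
   is taken invariant. *)
Definition ainf_map (f : A -> A) : ainf -> ainf :=
  quot_map (I := c0_pred) (sub_map (S := linf_pred) (fun x => f \o x)).

Definition central_seq_map (D : starSubalg A) (f : A -> A) :
    central_seq D -> central_seq D :=
  quot_map (I := @ann_pred D)
    (sub_map (S := @commutant_pred D) (ainf_map f)).

Definition separable_set (D : set A) :=
  exists C : set A, [/\ countable C, C `<=` D & D `<=` closure C].

End CentralSequences.

Section Groups.
Variable G : groupType.

Definition lcoset_equiv (H : groupClosed G) : rel G :=
  fun x y => (x^-1 * y)%g \in H.

Section Cosets.
Variable H : groupClosed G.

Fact lcoset_equiv_refl : reflexive (lcoset_equiv H).
Proof. by move=> x; rewrite /lcoset_equiv mulVg gpred1. Qed.

Fact lcoset_equiv_sym : symmetric (lcoset_equiv H).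
Proof.
by move=> x y; rewrite /lcoset_equiv -[RHS]gpredV invgM invgK.
Qed.

Fact lcoset_equiv_trans : transitive (lcoset_equiv H).
Proof.
move=> y x z xy yz; rewrite /lcoset_equiv -[z](mulVKg y) mulgA.
exact: gpredM.
Qed.

Canonical lcoset_equiv_equiv := EquivRel (lcoset_equiv H)
  lcoset_equiv_refl lcoset_equiv_sym lcoset_equiv_trans.

Definition lcosets := {eq_quot lcoset_equiv H}.

Definition lcosets_act (t : G) (c : lcosets) : lcosets :=
  \pi_lcosets (t * repr c)%g.

Lemma lcosets_act_pi t g :
  lcosets_act t (\pi_lcosets g) = \pi_lcosets (t * g)%g.
Proof.
apply/eqmodP => /=; have := reprK (\pi_lcosets g) => /eqmodP/=.
by rewrite /lcoset_equiv invgM -mulgA mulKg.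
Qed.

Definition finite_index := finite_set [set: lcosets].

End Cosets.

Definition residually_finite :=
  forall g : G, g != 1%g ->
    exists2 H : groupClosed G, finite_index H & g \notin H.

End Groups.

Section Rokhlin.
Variables (R : realType) (A : cstarAlgType R) (G : groupType).

Record is_action (alpha : G -> A -> A) : Prop := {
  action_aut : forall g, star_automorphism (alpha g);
  action_mul : forall g h a, alpha (g * h)%g a = alpha g (alpha h a)
}.

Variable alpha : G -> A -> A.

Definition pointwise_outer := forall g : G, g != 1%g -> ~ inner (alpha g).

Definition invariant (D : {pred A}) :=
  forall g, {in D, forall a, alpha g a \in D}.

(* C(G/H): for H of finite index, every function on G/H is continuous. *)
Definition coset_fun (H : groupClosed G) : Type := lcosets H -> R[i]^o.

Definition coset_fun_norm H (f : coset_fun H) : R := supnorm f.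

Definition coset_shift H (t : G) (f : coset_fun H) : coset_fun H :=
  fun c => f (lcosets_act t^-1%g c).

Definition Rokhlin_map H (D : starSubalg A)
    (phi : coset_fun H -> central_seq D) : Prop :=
  [/\ contractive (@coset_fun_norm H) (@central_seq_norm _ _ D) phi,
      completely_positive phi,
      order_zero phi &
      forall t f, phi (coset_shift t f) = central_seq_map (alpha t) (phi f)].

(* The identity of F(D, A), which exists since D is separable, is the unique
   element satisfying is_identity. *)
Definition Rokhlin_dim_le H (d : nat) : Prop :=
  forall D : starSubalg A, closed [set` D] -> separable_set [set` D] ->
    invariant D ->
    exists phi : 'I_d.+1 -> {linear coset_fun H -> central_seq D},
      (forall l, Rokhlin_map (phi l)) /\
      is_identity (\sum_l phi l (cst 1)).

Definition Rokhlin_dim_at H : \bar R :=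
  ereal_inf [set (d%:R)%:E | d in [set d | Rokhlin_dim_le H d]].

Definition Rokhlin_dim : \bar R :=
  ereal_sup [set x | exists2 H : groupClosed G,
    finite_index H & x = Rokhlin_dim_at H].

End Rokhlin.

(* Main.v *)
(* Suppose that alpha_g is implemented by a unitary b + lambda with b in A. Let
   D be a separable alpha-invariant C*-subalgebra containing b and a nonzero
   element. The image of b in A_oo commutes with A_oo `&` D', so alpha_g acts
   trivially on F(D, A). By residual finiteness there is a finite index
   subgroup N (a normal core) such that g fixes no coset of N. If phi is an
   equivariant order zero map from C(G/N) to F(D, A), then the indicators of
   c and g c are orthogonal and have the same image e under phi, so e^* e = 0
   and e = 0 by the C*-identity, hence phi 1 = 0. The unit of F(D, A) would
   then be 0, whereas a central approximate unit of D is nonzero in F(D, A).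

   Functional calculus is replaced by Cayley transforms. For k skew-adjoint
   and 1 - e = (1 - k)^-1 the element 1 - 2 e is unitary, so that 1 - e is a
   contraction; taking k = i n h with n large, 1 - e almost annihilates the
   self-adjoint element h, and products of such contractions almost annihilate
   finitely many given elements. Likewise every small self-adjoint h is
   i (e - e^* ) for some e with 1 - 2 e unitary, and since *-automorphisms
   preserve this relation, they are bounded. *)
Require Import Defs.
From HB Require Import structures.
From mathcomp Require Import all_boot all_order all_algebra.
From mathcomp Require Import all_classical all_reals all_analysis.
From mathcomp Require Import complex.

Set Implicit Arguments.
Unset Strict Implicit.
Unset Printing Implicit Defensive.

Import Order.TTheory GRing.Theory Num.Theory.
Import numFieldNormedType.Exports.

Local Open Scope classical_set_scope.
Local Open Scope ring_scope.
Local Open Scope quotient_scope.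

(** * Contractions of a complex Banach space *)

Lemma natSinv_lt (R : realType) (e : R[i]) : 0 < e ->
  exists N, forall n, (N <= n)%N -> n.+1%:R^-1 < e.
Proof.
move=> e0; have er : e = (complex.Re e)%:C%C.
  by rewrite RRe_real// gtr0_real.
have re0 : 0 < complex.Re e by move: e0; rewrite {1}er -[0]/(0%:C)%C ltcR.
have [N _ hN] := near_infty_natSinv_lt (PosNum re0).
exists N => n /hN /=; rewrite er -ltcR; congr (_ < _).
by rewrite fmorphV/= rmorph_nat.
Qed.

Lemma le_addgt0 (R : realType) (x y : R[i]) : 0 <= x -> 0 <= y ->
  (forall e, 0 < e -> x <= y + e) -> x <= y.
Proof.
move=> x0 y0 xy; have xr := ger0_real x0; have yr := ger0_real y0.
case: (real_leP xr yr) => // yx.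
have e0 : 0 < (x - y) / 2 by rewrite divr_gt0 // subr_gt0.
have := xy _ e0; rewrite -lerBlDl ler_pdivlMr// mulr_natr mulr2n gerDl.
by rewrite subr_le0 lt_geF.
Qed.

(** Banach's fixed point theorem on a closed ball: all iterates of [F] from 0 after the [n]-th stay
    within [2^-n r] of it, so they converge. It stands in for power series in the construction of
    quasi-unitaries and of resolvents. *)
Lemma half_fixpoint (R : realType) (V : completeNormedModType R[i])
    (F : V -> V) (r : R[i]) :
  0 <= r -> (forall x, `|x| <= r -> `|F x| <= r) ->
  (forall x y, `|x| <= r -> `|y| <= r -> `|F x - F y| <= 2^-1 * `|x - y|) ->
  exists2 x, `|x| <= r & F x = x.
Proof.
move=> r0 Fr Flip; pose x n := iter n F 0.
have xr n : `|x n| <= r by elim: n => [|n /Fr//]; rewrite normr0.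
have xlip n m : `|x (n + m)%N - x n| <= 2 ^- n * r.
  elim: n => [|n ih]; first by rewrite add0n expr0 invr1 mul1r subr0.
  by rewrite (le_trans (Flip _ _ _ _))// exprS invfM -mulrA ler_wpM2l.
have small e : 0 < e -> exists N, 2 ^- N * r < e.
  move=> e0; have r1 : 0 < r + 1 by rewrite ltr_wpDl.
  have [N hN] := natSinv_lt (divr_gt0 e0 r1).
  exists N; have := hN N (leqnn _); rewrite ltr_pdivlMr//.
  apply: le_lt_trans; apply: ler_pM => //; rewrite ?invr_ge0 ?exprn_ge0//.
    by rewrite lef_pV2 ?posrE// ?exprn_gt0// -natrX ler_nat ltn_expl.
  by rewrite lerDl.
have : cvg (x @ \oo).
  apply: cauchy_cvg; apply: cauchy_exP => e e0.
  have [N hN] := small e e0; exists (x N), N => // n /= Nn.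
  by rewrite -ball_normE /= distrC -(subnKC Nn) (le_lt_trans (xlip _ _)).
move=> /cvg_ex[l xl].
have xle e : 0 < e -> exists N, forall n, (N <= n)%N -> `|l - x n| < e.
  by move=> e0; have /cvgrPdist_lt/(_ e e0)[N _ hN] := xl; exists N => n /hN.
have lr : `|l| <= r.
  apply: le_addgt0 => // e /xle[N /(_ N (leqnn _)) hN].
  rewrite -[l](subrK (x N)) addrC (le_trans (ler_normD _ _))// lerD//.
  exact: ltW.
exists l => //; apply/subr0_eq/normr0_eq0/le_anti; rewrite normr_ge0 andbT.
apply: le_addgt0 => // e e0; rewrite add0r.
have [N hN] := xle _ (divr_gt0 e0 (ltr0Sn _ 1)).
rewrite -(subrK (x N.+1) (F l)) -addrA (le_trans (ler_normD _ _))//.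
rewrite [leRHS]splitr lerD//; last by rewrite distrC ltW// hN.
rewrite (le_trans (Flip _ _ _ _))// -[leRHS]mul1r ler_pM//.
  by rewrite invf_le1 ?ler1n.
exact/ltW/hN.
Qed.

(** * Quasi-unitary elements *)

Section StarAlgebraOpp.
Variables (K : numClosedFieldType) (V : starAlgType K).
Implicit Types x y : V.

Lemma smulNl x y : (- x) ** y = - (x ** y).
Proof. by rewrite -scaleN1r smulZl scaleN1r. Qed.

Lemma smulNr x y : x ** (- y) = - (x ** y).
Proof. by rewrite -scaleN1r smulZr scaleN1r. Qed.

Lemma starN x : star (- x) = - star x.
Proof. by rewrite -[- x]sub0r starB star0 sub0r. Qed.

Lemma scaler_halfD (W : lmodType K) (x : W) : 2^-1 *: (x + x) = x.
Proof. by rewrite scalerDr -scalerDl -[2^-1]mul1r -splitr scale1r. Qed.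

Lemma half_quarter : 2^-1 = 4^-1 + 4^-1 :> K.
Proof. by rewrite [LHS]splitr -invfM -natrM. Qed.

End StarAlgebraOpp.

Section QuasiUnitary.
Variables (R : realType) (A : cstarAlgType R).
Implicit Types a e h k x y : A.

(* e is quasi-unitary when 1 - 2 e is an isometry. *)
Definition quasi_unitary e := star e + e = star e ** e + star e ** e.

(** By the C*-identity [y = (1 - 2 e) a] has the norm of [a], and [(1 - e) a] is the mean of [a] and
    [y]. *)
Lemma quasi_unitary_le e a : quasi_unitary e -> `|a - e ** a| <= `|a|.
Proof.
move=> qe; pose y := a - (e ** a + e ** a).
have yE : star y ** y = star a ** a.
  have /(congr1 (fun t => star a ** t ** a)) := qe.
  rewrite !(smulDr, smulDl) => qa.
  rewrite /y !(starN, starD, starM, smulNl, smulNr, smulDl, smulDr) !smulA.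
  move: qa; rewrite !smulA.
  set p := star a ** a; set q := star a ** e ** a.
  set r := star a ** star e ** a; set s := _ ** e ** a => qa.
  by rewrite -qa opprB [r + q + _]addrACA addrK subrK.
have ny : `|y| = `|a|.
  apply/eqP; rewrite -(@eqrXn2 _ 2)//.
  by rewrite -!norm_star_smul yE.
have : a - e ** a = 2^-1 *: (a + y).
  by rewrite /y addrA scalerBr !scaler_halfD.
move=> ->; rewrite normrZ ger0_norm// mulrC ler_pdivrMr//.
by rewrite (le_trans (ler_normD _ _))// ny mulr_natr mulr2n.
Qed.

(** The C*-identity gives [2 |e|^2 = |star e + e| <= 2 |e|]. *)
Lemma quasi_unitary_norm e : quasi_unitary e -> `|e| <= 1.
Proof.
move=> qe; have [->|e0] := eqVneq e 0; first by rewrite normr0.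
have ep : 0 < `|e| by rewrite normr_gt0.
rewrite -(ler_pM2r ep) mul1r -expr2 -norm_star_smul -(@ler_pMn2r _ 2)//.
by rewrite -normrMn mulr2n -qe (le_trans (ler_normD _ _))// norm_star mulr2n.
Qed.

Lemma half_norm0 x : `|x| <= 2^-1 * `|x| -> x = 0.
Proof.
rewrite mulrC ler_pdivlMr// mulr_natr mulr2n gerDl normr_le0.
by move/eqP.
Qed.

Lemma self_adjoint_quasi_unitary h : star h = h -> `|h| <= 2^-1 ->
  exists2 e, quasi_unitary e & h = 'i *: (e - star e).
Proof.
(* If h commutes with a self-adjoint x = x^2 + h^2 / 4, then e = x - i h / 2
   satisfies e^* e = x, the real part of e. *)
move=> hs hn; pose F x : A := x ** x + 4^-1 *: (h ** h).
have r0 : 0 <= 4^-1 :> R[i] by [].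
(* Since [x^2 - y^2 = x (x - y) + (x - y) y], the radius 1/4 gives the ratio 1/4 + 1/4. *)
have Flip x y : `|x| <= 4^-1 -> `|y| <= 4^-1 ->
    `|F x - F y| <= 2^-1 * `|x - y|.
  move=> xr yr; have -> : F x - F y = x ** (x - y) + (x - y) ** y.
    by rewrite /F opprD addrACA subrr addr0 smulBr smulBl addrA subrK.
  rewrite (le_trans (ler_normD _ _))//.
  rewrite half_quarter.
  rewrite mulrDl lerD// (le_trans (ler_norm_smul _ _))//.
    by rewrite ler_wpM2r.
  by rewrite mulrC ler_wpM2r.
have Fr x : `|x| <= 4^-1 -> `|F x| <= 4^-1.
  move=> xr; rewrite (le_trans (ler_normD _ _))//.
  rewrite [leRHS](splitr 4^-1).
  rewrite lerD// ?normrZ ?ger0_norm//.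
    rewrite (le_trans (ler_norm_smul _ _))// ler_pM//.
    by rewrite (le_trans xr)// lef_pV2// ?posrE// ler_nat.
  rewrite ler_wpM2l// (le_trans (ler_norm_smul _ _))// -[leRHS]mul1r ler_pM//.
  by rewrite (le_trans hn)// invf_le1// ler1n.
have [x xr Fx] := half_fixpoint r0 Fr Flip.
(* [star x] is another fixed point in the ball, and a contraction has only one. *)
have xs : star x = x.
  apply/subr0_eq/half_norm0.
  have Fs : F (star x) = star x.
    rewrite -{2}Fx /F starD starM starZ starM hs.
    by rewrite fmorphV/= conjC_nat.
  by have := Flip (star x) x; rewrite Fs Fx norm_star; apply.
(* As [h] commutes with [h^2], the commutator satisfies [c = x c + c x], whence [|c| <= |c| / 2]. *)
have xh : x ** h = h ** x.
  apply/subr0_eq; set c := _ - _.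
  have cE : c = x ** c + c ** x.
    rewrite /c -{1 2}Fx /F smulDl smulDr smulZl smulZr smulBr smulBl -!smulA.
    by rewrite opprD addrACA subrr addr0 addrA subrK.
  apply: half_norm0; rewrite {1}cE (le_trans (ler_normD _ _))//.
  rewrite half_quarter.
  rewrite mulrDl lerD// (le_trans (ler_norm_smul _ _))//.
    by rewrite ler_wpM2r.
  by rewrite mulrC ler_wpM2r.
pose e := x - ('i / 2) *: h.
have es : star e = x + ('i / 2) *: h.
  rewrite /e starB starZ xs hs rmorphM fmorphV/= conjCi conjC_nat mulNr.
  by rewrite scaleNr opprK.
exists e; last first.
  rewrite es /e opprD addrACA subrr add0r -opprD -scalerDl -splitr.
  by rewrite scalerN scalerA mulCii scaleN1r opprK.
have eE : star e ** e = x.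
  rewrite es /e smulBr !smulDl !smulZl !smulZr xh opprD addrA addrK.
  rewrite scalerA -scaleNr -{3}Fx; congr (_ + _ *: _).
  by rewrite mulf_div mulCii mulNr opprK mul1r -natrM.
by rewrite /quasi_unitary eE es /e addrACA subrr addr0.
Qed.

(** Quasi-unitaries are mapped to quasi-unitaries, of norm at most 1, so self-adjoint
    [h = 'i (e - star e)] of norm at most 1/2 have images of norm at most 2. Scaling gives the bound
    4 on self-adjoint elements, and real and imaginary parts together give 8. *)
Lemma star_aut_bounded (f : A -> A) : star_automorphism f ->
  forall a, `|f a| <= 8 * `|a|.
Proof.
move=> [flin fM fs _].
have fD : {morph f : x y / x + y}.
  by move=> x y; have := flin 1 x y; rewrite !scale1r.
have f0 : f 0 = 0 by apply: (addrI (f 0)); rewrite -fD !addr0.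
have fZ c x : f (c *: x) = c *: f x by have := flin c x 0; rewrite f0 !addr0.
have fsmall h : star h = h -> `|h| <= 2^-1 -> `|f h| <= 2.
  move=> hs hn; have [e qe ->] := self_adjoint_quasi_unitary hs hn.
  have qfe : quasi_unitary (f e).
    by rewrite /quasi_unitary -fs -fM -!fD qe.
  rewrite fZ normrZ normCi mul1r fD -scaleN1r fZ scaleN1r fs.
  rewrite (le_trans (ler_normB _ _))// norm_star -[leRHS]/(1 + 1).
  by rewrite lerD// quasi_unitary_norm.
have fsa h : star h = h -> `|f h| <= 4 * `|h|.
  move=> hs; have [->|h0] := eqVneq h 0; first by rewrite f0 !normr0 mulr0.
  have hp : 0 < `|h| by rewrite normr_gt0.
  pose t := 2^-1 / `|h|; have t0 : 0 < t by rewrite divr_gt0.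
  have : `|f (t *: h)| <= 2.
    apply: fsmall; last first.
      by rewrite normrZ gtr0_norm// /t divfK// gt_eqF.
    rewrite starZ hs conj_Creal// ger0_real//; exact: ltW.
  rewrite fZ normrZ gtr0_norm// -ler_pdivlMl//.
  by rewrite /t invfM !invrK mulrAC -natrM.
move=> a; pose h1 := 2^-1 *: (a + star a).
pose h2 := (- 'i / 2) *: (a - star a).
have aE : a = h1 + 'i *: h2.
  rewrite /h1 /h2 scalerA mulrA mulrN mulCii opprK mul1r -scalerDr.
  by rewrite addrACA subrr addr0 scaler_halfD.
have h1s : star h1 = h1.
  by rewrite /h1 starZ starD starK addrC fmorphV/= conjC_nat.
have h2s : star h2 = h2.
  rewrite /h2 starZ starB starK rmorphM fmorphV/= conjC_nat -conjCi.
  by rewrite conjCK conjCi -[star a - a]opprB scalerN -scaleNr mulNr.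
have h1n : `|h1| <= `|a|.
  rewrite normrZ ger0_norm// mulrC ler_pdivrMr//.
  by rewrite (le_trans (ler_normD _ _))// norm_star mulr_natr mulr2n.
have h2n : `|h2| <= `|a|.
  rewrite normrZ normrM normrN normCi mul1r ger0_norm// mulrC ler_pdivrMr//.
  by rewrite (le_trans (ler_normB _ _))// norm_star mulr_natr mulr2n.
rewrite {1}aE fD (fZ 'i h2) (le_trans (ler_normD _ _))//.
rewrite [X in _ + X]normrZ normCi mul1r.
have -> : 8 = 4 + 4 :> R[i] by rewrite -natrD.
rewrite mulrDl lerD//.
  by rewrite (le_trans (fsa _ h1s))// ler_wpM2l.
by rewrite (le_trans (fsa _ h2s))// ler_wpM2l.
Qed.

End QuasiUnitary.

(** * Resolvents of skew-adjoint elements *)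

Section Resolvent.
Variables (R : realType) (A : cstarAlgType R).
Implicit Types a e h k x y : A.

(* That is, 1 - e is the inverse of 1 - k. *)
Definition resolvent k e := e = k ** e - k /\ e = e ** k - k.

Lemma resolvent_star k e : star k = - k -> resolvent k e ->
  resolvent (- k) (star e).
Proof.
move=> ks [e1 e2]; split.
  by rewrite {1}e2 starB starM ks.
by rewrite {1}e1 starB starM ks.
Qed.

(** [1 - 2 e = (1 + k) (1 - k)^-1] is the Cayley transform of [k]. In computations: multiply
    [e = k e - k] by [star e] on the left and use [star e k = k - star e]. *)
Lemma resolvent_quasi_unitary k e : star k = - k -> resolvent k e ->
  quasi_unitary e.
Proof.
move=> ks [e1 e2]; have [_ es] := resolvent_star ks (conj e1 e2).
have esk : star e ** k = k - star e.
  by rewrite {2}es smulNr opprK opprD addrCA subrr addr0 opprK.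
have := congr1 (fun t => star e ** t) e1.
rewrite /quasi_unitary smulBr smulA esk smulBl; set w := _ ** e => wE.
by rewrite {1}wE addrAC subrK opprB addrCA -e1.
Qed.

(* 1 - (k + K) = (1 - K) (1 - (1 - e) k), where (1 - e) k has norm at most 1/2
   however large K is, as 1 - e is a contraction. *)
Lemma skew_resolvent_step k K e : star k = - k -> star K = - K ->
  `|k| <= 2^-1 -> resolvent K e -> exists e', e' = (k + K) ** e' - (k + K).
Proof.
move=> ks Ks kn [e1 e2].
have qe := resolvent_quasi_unitary Ks (conj e1 e2).
pose z x := k ** x - (k + K); pose F x := z x - e ** z x.
(* This radius solves [r = r / 2 + |k + K|], so [F] preserves the ball. *)
have r0 : 0 <= 2 * `|k + K| by rewrite mulr_ge0.
have Fr x : `|x| <= 2 * `|k + K| -> `|F x| <= 2 * `|k + K|.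
  move=> xr; rewrite (le_trans (quasi_unitary_le _ qe))//.
  rewrite (le_trans (ler_normB _ _))// mulr_natl mulr2n lerD//.
  rewrite (le_trans (ler_norm_smul _ _))//.
  by rewrite (le_trans (ler_pM _ _ kn xr))// mulKf.
have Flip x y : `|x| <= 2 * `|k + K| -> `|y| <= 2 * `|k + K| ->
    `|F x - F y| <= 2^-1 * `|x - y|.
  move=> _ _; have -> : F x - F y = k ** (x - y) - e ** (k ** (x - y)).
    have -> : k ** (x - y) = z x - z y by rewrite /z opprB addrA subrK smulBr.
    rewrite smulBr /F !opprB addrACA [RHS]addrACA.
    by congr (_ + _); rewrite addrC.
  rewrite (le_trans (quasi_unitary_le _ qe))//.
  by rewrite (le_trans (ler_norm_smul _ _))// ler_wpM2r.
have [x _ Fx] := half_fixpoint r0 Fr Flip; exists x.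
(* This is [(1 - K) (1 - e) = 1] applied to [z x]; it turns [x = (1 - e) (z x)] into
   [(1 - K) x = z x]. *)
have Kez : K ** (e ** z x) = e ** z x + K ** z x.
  by rewrite {2}e1 smulBl smulA subrK.
have : x - K ** x = z x.
  by rewrite -{1 2}Fx /F smulBr Kez opprB addrK subrK.
by move=> /eqP; rewrite subr_eq /z addrAC -smulDl => /eqP.
Qed.

(** Adding one copy of [k] at a time keeps each increment small. Each step yields only a right
    inverse; the adjoint of the right inverse for [- k] is a left inverse. *)
Lemma skew_resolvent k n : star k = - k -> `|k| <= 2^-1 ->
  exists e, resolvent (k *+ n) e.
Proof.
move=> ks kn; elim: n => [|n [e re]].
  by exists 0; split; rewrite ?smul0 ?mul0s subr0.
have Ks : star (k *+ n) = - (k *+ n).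
  rewrite -mulNrn -ks; elim: {re} n => [|n ih]; first by rewrite star0.
  by rewrite !mulrS starD ih.
have [x xE] := skew_resolvent_step ks Ks kn re.
have ks' : star (- k) = - - k by rewrite starN ks.
have Ks' : star (- (k *+ n)) = - - (k *+ n) by rewrite starN Ks.
have kn' : `|- k| <= 2^-1 by rewrite normrN.
have [y yE] := skew_resolvent_step ks' Ks' kn' (resolvent_star Ks re).
have K's : star (k *+ n.+1) = - (k *+ n.+1) by rewrite mulrS starD ks Ks opprD.
rewrite -opprD -mulrS opprK in yE; rewrite -mulrS in xE.
exists x; split => //.
have yE' : star y = star y ** (k *+ n.+1) - k *+ n.+1.
  by rewrite {1}yE starD starM starN K's opprK.
(* A left and a right inverse agree: expand [w K x] in both ways. *)
move: (k *+ n.+1) (star y) xE yE' => K w xE wE.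
have Kx : K ** x = x + K by rewrite {2}xE subrK.
have wK : w ** K = w + K by rewrite {2}wE subrK.
have := smulA w K x; rewrite Kx wK smulDr smulDl Kx wK => /addrI/addIr wx.
by rewrite -{1}wx {1}wE wx.
Qed.

(** For [k = 'i c h] and [e] the resolvent of [n k], the element [(1 - e) (n k) = - e] has norm at
    most 1, so [|(1 - e) h| <= 1 / (n c)]. The factor [c] ensures [|k| <= 1/2]. *)
Lemma self_adjoint_unit h (eps : R[i]) : star h = h -> 0 < eps ->
  exists2 e, quasi_unitary e & `|h - e ** h| <= eps.
Proof.
move=> hs eps0; pose c : R[i] := (2 * (`|h| + 1))^-1.
have h1 : 0 < `|h| + 1 by rewrite ltr_wpDl.
have c0 : 0 < c by rewrite invr_gt0 mulr_gt0.
pose k := ('i * c) *: h.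
have ks : star k = - k.
  rewrite /k starZ hs rmorphM/= conjCi mulNr scaleNr; congr (- (_ * _ *: _)).
  by rewrite conj_Creal// ger0_real// ltW.
have kn : `|k| <= 2^-1.
  rewrite normrZ normrM normCi mul1r gtr0_norm// /c invfM -mulrA.
  by rewrite ler_piMr// ler_pdivrMl// mulr1 lerDl.
have [N /(_ _ (leqnn N)) hN] := natSinv_lt (mulr_gt0 c0 eps0).
have [e re] := skew_resolvent N.+1 ks kn.
have Ks : star (k *+ N.+1) = - (k *+ N.+1).
  have f n : star (k *+ n) = - (k *+ n).
    elim: n => [|n ih]; first by rewrite star0 oppr0.
    by rewrite !mulrS starD ih ks opprD.
  exact: f.
have qe := resolvent_quasi_unitary Ks re.
exists e => //.
have : `|k *+ N.+1 - e ** (k *+ N.+1)| <= 1.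
  by rewrite -normrN opprB -re.2 quasi_unitary_norm.
rewrite /k -scaler_nat scalerA smulZr -scalerBr normrZ !normrM normCi mul1r.
rewrite (gtr0_norm c0) normr_nat -ler_pdivlMl ?mulr_gt0// mulr1 => /le_trans.
apply; rewrite invfM mulrC ler_pdivrMl//; exact: ltW.
Qed.

End Resolvent.

(** * Approximate units *)

Section ApproximateUnit.
Variables (R : realType) (A : cstarAlgType R).
Implicit Types (a e d x : A) (s : seq A) (eps : R[i]).

(** This is [(1 - f) (1 - e) = 1 - (f + e - f e)], stated without an identity element. *)
Lemma smul_circle f e a :
  a - (f + e - f ** e) ** a = (a - e ** a) - f ** (a - e ** a).
Proof.
rewrite smulBl smulDl smulBr -smulA.
by rewrite [f ** a + e ** a]addrC -[_ + _ - f ** _]addrA opprD addrA.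
Qed.

Lemma finite_left_unit s eps : 0 < eps ->
  exists2 e, (forall a, `|a - e ** a| <= `|a|) &
    {in s, forall a, `|a - e ** a| <= eps}.
Proof.
move=> eps0; elim: s => [|b s [e e1 es]].
  by exists 0 => // a; rewrite mul0s subr0.
pose y := b - e ** b.
(* It suffices that 1 - f almost annihilates y y^*, by the C*-identity. *)
have ys : star (y ** star y) = y ** star y by rewrite starM starK.
have [f qf fy] := self_adjoint_unit ys (exprn_gt0 2 eps0).
have f1 a := quasi_unitary_le a qf.
have efE a := smul_circle f e a.
(* The new factor [1 - f] is a contraction on the left, so the estimates already obtained on [s]
   survive. *)
exists (f + e - f ** e) => [a|a].
  by rewrite efE (le_trans (f1 _)).
rewrite in_cons efE => /orP[/eqP->|/es]; last exact: le_trans.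
rewrite -/y -(@ler_pXn2r _ 2) ?nnegrE ?(ltW eps0)//.
set t := y - f ** y; pose w := t ** star y.
have wE : w = y ** star y - f ** (y ** star y) by rewrite /w smulBl smulA.
(* [t (star t) = (1 - f) (star w)], since [star w = y (star t)]; hence [|t|^2 <= |w|]. *)
have -> : `|t| ^+ 2 = `|star w - f ** star w|.
  have := norm_star_smul (star t); rewrite starK norm_star => <-.
  by rewrite starM starK {1}/t smulBl -smulA.
by rewrite (le_trans (f1 _))// norm_star wE.
Qed.

(** Taking [1 - x = (1 - star e) (1 - e)] makes [x] self-adjoint. Testing the contraction on
    [star e] gives [|e| <= 2], whence [|x| <= 2 + 2 + 4]. *)
Lemma finite_unit s eps : 0 < eps ->
  exists x, [/\ star x = x, `|x| <= 8 & {in s, forall a, `|x ** a - a| <= eps}].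
Proof.
move=> eps0; have eps3 : 0 < eps / 3 by rewrite divr_gt0.
have [e e1 es] := finite_left_unit s eps3.
have en : `|e| <= 2.
  have [->|e0] := eqVneq e 0; first by rewrite normr0.
  have ep : 0 < `|star e| by rewrite norm_star normr_gt0.
  have : `|e ** star e| <= 2 * `|star e|.
    rewrite -[e ** _](subKr (star e)) (le_trans (ler_normB _ _))//.
    by rewrite mulr_natl mulr2n lerD.
  by rewrite -{1}[e]starK norm_star_smul expr2 ler_pM2r// norm_star.
pose x := star e + e - star e ** e; exists x; split.
- by rewrite /x starB starD starM starK [_ + star e]addrC.
- rewrite (le_trans (ler_normB _ _))//.
  have -> : 8 = 2 + 2 + 2 * 2 :> R[i] by rewrite -natrM -!natrD.
  rewrite lerD//.
    by rewrite (le_trans (ler_normD _ _))// norm_star lerD.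
  by rewrite (le_trans (ler_norm_smul _ _))// norm_star ler_pM.
move=> a /es ae; rewrite distrC.
rewrite smul_circle (le_trans (ler_normB _ _))//.
have -> : eps = eps / 3 + 2 * (eps / 3).
  rewrite -{1}[eps / 3]mul1r -mulrDl -[1]/(1%:R) -natrD mulrC.
  by rewrite divfK ?pnatr_eq0.
rewrite lerD// (le_trans (ler_norm_smul _ _))// norm_star ler_pM//.
Qed.

(** [x n] is a unit up to [1 / (n + 1)] for the first [n + 1] terms of [c]; the uniform bound 8
    carries convergence over to the closure. *)
Lemma approximate_unit (c : nat -> A) : exists x : nat -> A,
  [/\ forall n, star (x n) = x n, forall n, `|x n| <= 8 &
    forall d, closure (range c) d -> (fun n => x n ** d - d) @ \oo --> (0 : A)].
Proof.
have hx n : exists x, [/\ star x = x, `|x| <= 8 &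
    {in map c (iota 0 n.+1), forall a, `|x ** a - a| <= n.+1%:R^-1}].
  by apply: finite_unit; rewrite invr_gt0.
have [x {}hx] := choice hx; exists x; split=> [n|n|d cd].
- by have [] := hx n.
- by have [] := hx n.
apply/cvgr0Pnorm_lt => eps eps0.
(* The three errors below amount to [8 + 1 + 1] times this quantity, that is [eps / 2]. *)
have e0 : 0 < eps / 20 by rewrite divr_gt0.
have := cd _ (nbhsx_ballx d _ e0) => -[_ [[k _ <-] /=]].
rewrite -ball_normE /= => dk.
have [N hN] := natSinv_lt e0.
exists (maxn N k) => // n /=; rewrite geq_max => /andP[Nn kn].
have [_ xn] := hx n => /(_ (c k)) xk.
have {}xk : `|x n ** c k - c k| <= eps / 20.
  rewrite (le_trans (xk _)) ?ltW ?hN//.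
  by rewrite map_f// mem_iota.
have -> : x n ** d - d = x n ** (d - c k) + (x n ** c k - c k) + (c k - d).
  by rewrite smulBr !addrA !subrK.
have : `|x n ** (d - c k) + (x n ** c k - c k) + (c k - d)|
   <= 8 * (eps / 20) + eps / 20 + eps / 20.
  rewrite (le_trans (ler_normD _ _))// lerD//; last by rewrite distrC ltW.
  rewrite (le_trans (ler_normD _ _))// lerD//.
  by rewrite (le_trans (ler_norm_smul _ _))// ler_pM// ltW.
move/le_lt_trans; apply.
rewrite -addrA -[X in _ + X]mulr2n -[X in _ + X]mulr_natl -mulrDl -natrD.
by rewrite mulrA ltr_pdivrMr// mulrC ltr_pM2l// ltr_nat.
Qed.

End ApproximateUnit.

(** * Separable invariant subalgebras *)

Lemma countable_range (T : Type) (t0 : T) : countable [set: T] ->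
  exists c : nat -> T, forall t, exists n, c n = t.
Proof.
move=> /pfcard_geP[T0|[c]].
  by have : [set: T] t0 by []; rewrite T0.
exists c => t; have [n _ <-] := (@surj _ _ _ _ c) t I; by exists n.
Qed.

(** Terms built from the generators and operations are finite trees labelled by natural numbers,
    hence countable, and [c] lists their values. Trees of another arity and invalid codes are sent
    to [gen 0]. *)
Lemma countable_algebra (T : Type) (gen : nat -> T) (un : nat -> T -> T)
    (bin : nat -> T -> T -> T) :
  exists c : nat -> T, [/\ forall n, range c (gen n),
    forall n x, range c x -> range c (un n x) &
    forall n x y, range c x -> range c y -> range c (bin n x y)].
Proof.
pose fix ev (t : GenTree.tree nat) : T :=
  match t with
  | GenTree.Leaf n => gen n
  | GenTree.Node n ts => match ts with
    | [:: x] => un n (ev x)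
    | [:: x; y] => bin n (ev x) (ev y)
    | _ => gen 0%N
    end
  end.
pose c n := if (unpickle n : option (GenTree.tree nat)) is Some t then ev t
            else gen 0%N.
have cP t : range c (ev t) by exists (pickle t) => //; rewrite /c pickleK.
have Pc x : range c x -> exists t, x = ev t.
  move=> [n _ <-]; rewrite /c; case: unpickle => [t|]; first by exists t.
  by exists (GenTree.Leaf 0%N).
exists c; split=> [n|n x /Pc[t ->]|n x y /Pc[t ->] /Pc[s ->]].
- exact: (cP (GenTree.Leaf n)).
- exact: (cP (GenTree.Node n [:: t])).
- exact: (cP (GenTree.Node n [:: t; s])).
Qed.

Lemma ratC_dense (R : realType) (z e : R[i]) : 0 < e ->
  exists q : rat * rat, `|z - (ratr q.1 + 'i * ratr q.2)| < e.
Proof.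
move=> e0; have er : e = (complex.Re e)%:C%C.
  by rewrite RRe_real// gtr0_real.
have re0 : 0 < complex.Re e / 2.
  by rewrite divr_gt0//; move: e0; rewrite er -[0]/(0%:C)%C ltcR.
have approx (x : R) : exists q : rat, `|x - ratr q| < complex.Re e / 2.
  have [q] : exists q, ratr q \in `]x - complex.Re e / 2, x + complex.Re e / 2[.
    by apply: rat_in_itvoo; rewrite ltrBlDr -addrA ltrDl addr_gt0.
  by rewrite in_itv/= => xq; exists q; rewrite distrC ltr_distl.
have [q1 h1] := approx (complex.Re z); have [q2 h2] := approx (complex.Im z).
exists (q1, q2) => /=.
have ratC (q : rat) : ratr q = (ratr q : R)%:C%C :> R[i].
  by rewrite fmorph_rat.
have iE : 'i = 'i%C :> R[i] by [].
have normRC (x : R) : `|x%:C%C| = (`|x|)%:C%C :> R[i].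
  by rewrite normc_def/= expr0n addr0 sqrtr_sqr.
have -> : z - (ratr q1 + 'i * ratr q2)
    = (complex.Re z - ratr q1)%:C%C + 'i * (complex.Im z - ratr q2)%:C%C.
  rewrite !ratC {1}[z]complexE -iE !rmorphB/= mulrBr opprD addrACA.
  by [].
rewrite (le_lt_trans (ler_normD _ _))// normrM normCi mul1r !normRC.
by rewrite -rmorphD er ltcR [ltRHS]splitr ltrD.
Qed.

Section Closure.
Variables (R : realType) (V : normedModType R[i]) (C : set V).

Lemma closure_ltP x : closure C x <->
  forall e, 0 < e -> exists2 c, C c & `|x - c| < e.
Proof.
split=> [Cx e e0|h B /nbhs_ballP[e /= e0 eB]].
  have [c [cC]] := Cx _ (nbhsx_ballx x _ e0).
  by rewrite -ball_normE; exists c.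
by have [c cC xc] := h e e0; exists c; split=> //; apply: eB;
  rewrite -ball_normE.
Qed.

Lemma closure_lipschitz (f : V -> V) (M : R[i]) :
  (forall x y, `|f x - f y| <= M * `|x - y|) ->
  (forall c, C c -> closure C (f c)) ->
  forall x, closure C x -> closure C (f x).
Proof.
move=> fM fC x /closure_ltP Cx; apply/closure_ltP => e e0.
have M1 : 0 < `|M| + 1 by rewrite ltr_wpDl.
have e2 : 0 < e / 2 by rewrite divr_gt0.
have [c cC xc] := Cx _ (divr_gt0 e2 M1).
have /closure_ltP/(_ _ e2)[d dC cd] := fC c cC; exists d => //.
rewrite -(subrK (f c) (f x)) -addrA [ltRHS]splitr.
rewrite (le_lt_trans (ler_normD _ _))// ltr_leD ?(ltW cd)//.
rewrite (le_lt_trans (fM _ _))//.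
move: xc; rewrite ltr_pdivlMr// mulrC; apply: le_lt_trans.
have M0 : 0 <= M * `|x - c| by rewrite (le_trans _ (fM _ _)).
by rewrite -(ger0_norm M0) normrM normr_id ler_wpM2r// lerDl.
Qed.

End Closure.

(** A countable set containing [a] and [b] and closed under the algebraic operations, Gaussian
    rational scalars and all [alpha g] has the required closure. Each operation is Lipschitz in each
    variable, automorphisms by [star_aut_bounded], so it passes to the closure. *)
Lemma separable_invariant_subalg (R : realType) (A : cstarAlgType R)
    (G : groupType) (alpha : G -> A -> A) (a b : A) :
  countable [set: G] -> is_action alpha ->
  exists (D : starSubalg A) (c : nat -> A),
    [/\ [set` D] = closure (range c), separable_set [set` D],
        Defs.invariant alpha D, a \in D & b \in D].
Proof.
move=> /(countable_range (1%g : G))[gam gamP] [aut _].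
pose gen n := if n is 0%N then a else b.
pose bin n := if n is 0%N then fun x y : A => x + y else fun x y => x ** y.
pose un n : A -> A :=
  match unpickle n : option (nat + option (rat * rat)) with
  | Some (inl m) => alpha (gam m)
  | Some (inr (Some q)) => fun x => (ratr q.1 + 'i * ratr q.2) *: x
  | _ => @star _ _
  end.
have [c [cgen cun cbin]] := countable_algebra gen un bin.
pose C := range c.
have Calpha g x : C x -> C (alpha g x).
  move=> Cx; have [m <-] := gamP g.
  by have := cun (pickle (inl m : nat + option (rat * rat))) x Cx;
     rewrite /un pickleK.
have Cstar x : C x -> C (star x).
  move=> Cx; have := cun (pickle (inr None : nat + option (rat * rat))) x Cx.
  by rewrite /un pickleK.
have Cq (q : rat * rat) x : C x -> C ((ratr q.1 + 'i * ratr q.2) *: x).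
  move=> Cx.
  have := cun (pickle (inr (Some q) : nat + option (rat * rat))) x Cx.
  by rewrite /un pickleK.
have CC := @subset_closure _ C.
have Sadd x y : closure C x -> closure C y -> closure C (x + y).
  move=> Cx Cy; apply: (closure_lipschitz (f := +%R^~ y) (M := 1)) Cx.
    by move=> u v; rewrite opprD addrACA subrr addr0 mul1r.
  move=> u Cu; apply: (closure_lipschitz (f := +%R u) (M := 1)) Cy.
    by move=> v w; rewrite opprD addrACA subrr add0r mul1r.
  by move=> v Cv; apply/CC/(cbin 0%N).
have Smul x y : closure C x -> closure C y -> closure C (x ** y).
  move=> Cx Cy.
  apply: (closure_lipschitz (f := fun z => z ** y) (M := `|y|)) Cx.
    by move=> u v; rewrite -smulBl mulrC ler_norm_smul.
  move=> u Cu; apply: (closure_lipschitz (f := fun z => u ** z) (M := `|u|)) Cy.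
    by move=> v w; rewrite -smulBr ler_norm_smul.
  by move=> v Cv; apply/CC/(cbin 1%N).
have Sstar x : closure C x -> closure C (star x).
  apply: (closure_lipschitz (M := 1)).
    by move=> u v; rewrite -starB norm_star mul1r.
  by move=> u /Cstar/CC.
have Sscale k x : closure C x -> closure C (k *: x).
  apply: (closure_lipschitz (M := `|k|)).
    by move=> u v; rewrite -scalerBr normrZ.
  (* A general scalar need not preserve [C]; it is approximated by Gaussian rationals within
     [e / (|u| + 1)]. *)
  move=> u Cu; apply/closure_ltP => e e0.
  have u1 : 0 < `|u| + 1 by rewrite ltr_wpDl.
  have [q kq] := ratC_dense k (divr_gt0 e0 u1).
  exists ((ratr q.1 + 'i * ratr q.2) *: u); first exact: Cq.
  move: kq; rewrite -scalerBl normrZ ltr_pdivlMr//; apply: le_lt_trans.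
  by rewrite ler_wpM2l// lerDl.
have Salpha g x : closure C x -> closure C (alpha g x).
  apply: (closure_lipschitz (M := 8)); last by move=> u /(Calpha g)/CC.
  move=> u v; have [lin _ _ _] := aut g.
  have -> : alpha g u - alpha g v = alpha g (u - v).
    by rewrite addrC -scaleN1r -lin scaleN1r addrC.
  exact: star_aut_bounded.
have Sa : closure C a by apply/CC/(cgen 0%N).
have Sb : closure C b by apply/CC/(cgen 1%N).
pose P : {pred A} := [pred x | `[< closure C x >]].
have Padd : addr_closed P.
  split=> [|x y /asboolP Cx /asboolP Cy]; apply/asboolP; last exact: Sadd.
  by rewrite -(scale0r a); apply: Sscale.
have Pscale : scaler_closed P.
  by move=> k x /asboolP Cx; apply/asboolP/Sscale.
have Pmul : {in P &, forall x y, x ** y \in P}.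
  by move=> x y /asboolP Cx /asboolP Cy; apply/asboolP/Smul.
have Pstar : {in P, forall x, star x \in P}.
  by move=> x /asboolP Cx; apply/asboolP/Sstar.
pose D : starSubalg A := HB.pack_for (starSubalg A) P
  (GRing.isAddClosed.Build A P Padd)
  (GRing.isScaleClosed.Build R[i] A P Pscale)
  (isStarMulClosed.Build R[i] A P Pmul Pstar).
have DE : [set` D] = closure C.
  by apply/seteqP; split=> x; [move=> /asboolP|move=> ?; apply/asboolP].
exists D, c; split=> //.
- exists C; split; rewrite ?DE//.
  exact: card_image_le.
- by move=> g x /asboolP Cx; apply/asboolP/Salpha.
- exact/asboolP.
- exact/asboolP.
Qed.

(** * Cosets of the normal core *)

Section NormalCore.
Variables (G : groupType) (H : groupClosed G).

Lemma lcosets_piP (K : groupClosed G) (x y : G) :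
  \pi_(lcosets K) x = \pi_(lcosets K) y <-> (x^-1 * y)%g \in K.
Proof. by split=> [/eqmodP/=|h]//; apply/eqmodP => /=. Qed.

Lemma lcosets_piE (K : groupClosed G) (c : lcosets K) :
  exists z, c = \pi_(lcosets K) z.
Proof. by exists (repr c); rewrite reprK. Qed.

Lemma lcosets_actM (x y : G) (c : lcosets H) :
  lcosets_act (x * y)%g c = lcosets_act x (lcosets_act y c).
Proof. by have [z ->] := lcosets_piE c; rewrite !lcosets_act_pi mulgA. Qed.

Lemma lcosets_act1 (c : lcosets H) : lcosets_act 1%g c = c.
Proof. by have [z ->] := lcosets_piE c; rewrite lcosets_act_pi mul1g. Qed.

(** [N] is the kernel of the action on the cosets of [H]. If [g] fixed [x N], then the conjugate of
    [g] by [x^-1] would fix the coset [x^-1 H], forcing [g] into [H]. *)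
Lemma normal_core_free (g : G) : finite_index H -> g \notin H ->
  exists2 N : groupClosed G, finite_index N &
    forall c : lcosets N, lcosets_act g c <> c.
Proof.
move=> Hfin gH.
pose P : {pred G} :=
  [pred x | `[< forall c : lcosets H, lcosets_act x c = c >]].
have P1 : (1%g : G) \in P by apply/asboolP => c; rewrite lcosets_act1.
have PM : {in P &, forall x y, (x * y)%g \in P}.
  move=> x y /asboolP hx /asboolP hy; apply/asboolP => c.
  by rewrite lcosets_actM hy hx.
have PV : {in P, forall x, x^-1%g \in P}.
  move=> x /asboolP hx; apply/asboolP => c.
  by rewrite -{1}(hx c) -lcosets_actM mulVg lcosets_act1.
pose N : groupClosed G := HB.pack_for (groupClosed G) P
  (isInvClosed.Build G P PV) (isMul1Closed.Build G P P1)
  (isMulClosed.Build G P PM).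
exists N.
  have [s sE] := (finite_seqP _).1 Hfin.
  have s_all c : c \in s by have : [set: lcosets H] c by []; rewrite sE.
  have [c0 _] : exists c : lcosets H, True by exists (\pi_(lcosets H) 1%g).
  (* A coset of [N] is coded by the way a representative permutes the finite list [s] of cosets of
     [H]; equal codes mean equal actions. *)
  pose f (d : lcosets N) : {ffun 'I_(size s) -> 'I_(size s).+1} :=
    [ffun i : 'I_(size s) =>
      inord (index (lcosets_act (repr d) (nth c0 s i)) s)].
  have finj : injective f.
    move=> d d' /ffunP dd'; rewrite -[d]reprK -[d']reprK; apply/lcosets_piP.
    apply/asboolP => c; rewrite lcosets_actM.
    have ci : (index c s < size s)%N by rewrite index_mem.
    have := dd' (Ordinal ci); rewrite !ffunE/= nth_index// => /(congr1 val)/=.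
    rewrite !inordK ?ltnS ?index_size// => /(congr1 (nth c0 s)).
    rewrite !nth_index// => <-.
    by rewrite -lcosets_actM mulVg lcosets_act1.
  rewrite /finite_index; have -> : [set: lcosets N] = f @^-1` setT by [].
  by apply: finite_preimage => //; apply: in2W.
move=> c; have [x ->] := lcosets_piE c.
rewrite lcosets_act_pi => /lcosets_piP/asboolP.
move=> /(_ (\pi_(lcosets H) x^-1%g)); rewrite lcosets_act_pi => /lcosets_piP.
by rewrite mulgK invgK mulgK => gH'; rewrite gH' in gH.
Qed.

End NormalCore.

(** * Central sequences *)

Lemma quot_pi_eq0 (K : numClosedFieldType) (V : starAlgType K)
    (I : starIdeal V) (x : V) : quot_pi I x = 0 <-> x \in I.
Proof.
have pi0 : quot_pi I 0 = 0.
  by apply: (addrI (quot_pi I 0)); rewrite -quot_piD !addr0.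
by rewrite -pi0 quot_piP subr0.
Qed.

Section CentralSequenceAlgebra.
Variables (R : realType) (A : cstarAlgType R).

Lemma to_ainf_eq0 (a : A) : to_ainf a = 0 -> a = 0.
Proof.
move/quot_pi_eq0/asboolP => /= h.
by apply: (@cvg_unique _ _ (cst a @ \oo)) => //; apply: cvg_cst.
Qed.

Lemma ainf_star_mul_eq0 (y : ainf A) : star y ** y = 0 -> y = 0.
Proof.
rewrite -(quot_reprK y); set w := quot_repr y.
rewrite -quot_pi_star -quot_piM => /quot_pi_eq0/asboolP/cvgr0Pnorm_lt ww.
apply/quot_pi_eq0/asboolP/cvgr0Pnorm_lt => e e0.
have := ww _ (exprn_gt0 2 e0); apply: filterS => n /=.
rewrite [X in `|X| < _ -> _]/(star (val w n) ** val w n) norm_star_smul.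
by rewrite ltr_pXn2r ?nnegrE ?(ltW e0).
Qed.

Section Relative.
Variable D : starSubalg A.

(** If [star x x] annihilates [D], then [star (x d) (x d) = 0], so [x d = 0] by the case of [A_oo];
    [d x = 0] follows because [x] commutes with [d]. *)
Lemma central_seq_star_mul_eq0 (e : central_seq D) : star e ** e = 0 -> e = 0.
Proof.
rewrite -(quot_reprK e); set x := quot_repr e.
rewrite -quot_pi_star -quot_piM => /quot_pi_eq0/asboolP xx.
have xd : {in D, forall d, val x ** to_ainf d = 0}.
  move=> d /xx[xxd _]; apply: ainf_star_mul_eq0.
  by rewrite starM -smulA [X in _ ** X]smulA xxd smul0.
apply/quot_pi_eq0/asboolP => d dD; rewrite xd//; split=> //.
by have /asboolP <- := valP x; rewrite ?xd.
Qed.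

(** With [u = b + l], the sequence class [x] commutes with [b], so
    [u x (star u) = x u (star u) = x]. All is expanded inside [A_oo], as [u] lies only in the
    unitization. *)
Lemma ainf_map_inner (f : A -> A) (u : unitization A) (x : ainf A) :
  unitary u ->
  (forall a, to_unitization (f a) = u ** to_unitization a ** star u) ->
  u.1 \in D -> x \in commutant_pred D -> ainf_map f x = x.
Proof.
case: u => b l [_ uu] fE /= bD /asboolP xD.
have {uu} [bb ll] : b ** star b + l^* *: b + l *: star b = 0 /\ l * l^* = 1.
  by case: uu.
have fbl a : f a = (b ** a + l *: a) ** star b + l^* *: (b ** a + l *: a).
  have /(congr1 fst)/= := fE a; rewrite /= => ->.
  by rewrite mulr0 !scale0r !addr0.
pose cb : linf A := exist _ (cst b) (cst_linf b).
pose r := quot_repr x.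
pose y : linf A := (cb ** r + l *: r) ** star cb + l^* *: (cb ** r + l *: r).
have yE : f \o val r = val y by apply/funext => n; rewrite /= fbl.
(* The image sequence is [y], which is bounded, so [sub_map] does not fall back on its default 0. *)
have -> : ainf_map f x = quot_pi (@c0_pred R A) y.
  congr quot_pi; apply: val_inj; rewrite val_sub_map yE//; exact: valP.
rewrite /y !(quot_piD, quot_piM, quot_piZ, quot_pi_star) quot_reprK.
rewrite -/(to_ainf b) -xD//.
set B := to_ainf b.
have bb' : B ** star B + l^* *: B + l *: star B = 0.
  rewrite -quot_pi_star -quot_piM -!quot_piZ -!quot_piD; apply/quot_pi_eq0.
  rewrite [X in X \in _](_ : _ = 0) ?rpred0//.
  by apply: val_inj; apply/funext => n; exact: bb.
have : x ** (B ** star B + l^* *: B + l *: star B) = 0 by rewrite bb' smul0.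
rewrite !smulDr !smulZr smulA => xB.
rewrite smulDl smulZl scalerDr scalerA [l^* * l]mulrC ll scale1r.
by rewrite addrA [_ + l *: _ + l^* *: _]addrAC xB add0r.
Qed.

Lemma central_seq_map_inner (f : A -> A) (u : unitization A)
    (z : central_seq D) :
  unitary u ->
  (forall a, to_unitization (f a) = u ** to_unitization a ** star u) ->
  u.1 \in D -> central_seq_map f z = z.
Proof.
move=> uu fE bD; rewrite -[RHS]quot_reprK; congr quot_pi; apply: val_inj.
have h : ainf_map f (val (quot_repr z)) = val (quot_repr z).
  exact: (ainf_map_inner uu fE bD (valP _)).
by rewrite val_sub_map h//; apply: valP.
Qed.

(** The class [X] of an approximate unit for [D] satisfies [X d = d = d X], so it is in the
    commutant even though its terms are only taken in [A]. Were 0 an identity, [X] would annihilate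
    [D] and [d] would vanish. *)
Lemma central_seq_neq0 (c : nat -> A) (d : A) :
  [set` D] = closure (range c) -> d \in D -> d <> 0 ->
  ~ is_identity (0 : central_seq D).
Proof.
move=> Dc dD d0 id0; have [x [xs xn xd]] := approximate_unit c.
have xlinf : x \in @linf_pred R A by apply/asboolP; exists 8.
pose X : ainf A := quot_pi (@c0_pred R A) (exist _ x xlinf).
have Xd a : a \in D -> X ** to_ainf a = to_ainf a.
  move=> aD; rewrite -quot_piM; apply/quot_piP/asboolP.
  have ca : closure (range c) a by rewrite -Dc.
  exact: xd ca.
have Xs : star X = X.
  by rewrite -quot_pi_star; congr quot_pi; apply: val_inj; apply/funext.
have dX a : a \in D -> to_ainf a ** X = to_ainf a.
  move=> aD; rewrite -[LHS]starK starM Xs -to_ainf_star Xd ?rpred_star//.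
  by rewrite to_ainf_star starK.
have XD : X \in commutant_pred D by apply/asboolP => a aD; rewrite Xd ?dX.
pose Y : central_seq D := quot_pi (@ann_pred R A D) (exist _ X XD).
have : Y = 0 by have [_ <-] := id0 Y; rewrite smul0.
move=> /quot_pi_eq0/asboolP/(_ d dD)[/= + _].
by rewrite Xd// => /to_ainf_eq0.
Qed.

End Relative.
End CentralSequenceAlgebra.

(** * Rokhlin maps *)

Lemma Rokhlin_dim_fin (R : realType) (A : cstarAlgType R) (G : groupType)
    (alpha : G -> A -> A) (H : groupClosed G) :
  (Rokhlin_dim alpha < +oo)%E -> finite_index H ->
  exists d, Rokhlin_dim_le alpha H d.
Proof.
move=> dimfin Hfin.
have : (Rokhlin_dim_at alpha H < +oo)%E.
  by apply: le_lt_trans dimfin; apply: ereal_sup_ubound; exists H.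
move=> /ereal_inf_lt[_ [d dP _] _]; by exists d.
Qed.

Section CosetIndicators.
Variables (R : realType) (G : groupType) (H : groupClosed G).

Definition coset_indicator (c : lcosets H) : coset_fun R H :=
  fun c' => (c' == c)%:R.

Lemma coset_indicator_orthogonal c c' : c <> c' ->
  Defs.orthogonal (coset_indicator c) (coset_indicator c').
Proof.
move=> /eqP cc'; have ind0 d : (d == c)%:R * (d == c')%:R = 0 :> R[i].
  by case: eqP => [->|_]; rewrite ?(negbTE cc') ?mulr0 ?mul0r.
split; apply/funext => d; apply: etrans (ind0 d).
- by [].
- exact: mulrC.
- by congr (_ * _); exact: conjC_nat.
- by rewrite mulrC; congr (_ * _); exact: conjC_nat.
Qed.

Lemma coset_shift_indicator (g : G) c :
  coset_shift g (coset_indicator c) = coset_indicator (lcosets_act g c).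
Proof.
apply/funext => d; rewrite /coset_shift /coset_indicator.
congr ((nat_of_bool _)%:R).
apply/idP/idP => /eqP; [move=> <-|move=> ->].
  by rewrite -lcosets_actM mulgV lcosets_act1.
by rewrite -lcosets_actM mulVg lcosets_act1.
Qed.

Lemma sum_coset_indicator (s : seq (lcosets H)) : [set: lcosets H] = [set` s] ->
  uniq s -> (cst 1 : coset_fun R H) = \sum_(c <- s) coset_indicator c.
Proof.
move=> sE us; apply/funext => d.
have ds : d \in s by have : [set: lcosets H] d by []; rewrite sE.
rewrite fct_sumE (bigD1_seq d)//= /coset_indicator eqxx big1 ?addr0//.
by move=> c /negbTE cd; rewrite eq_sym cd.
Qed.

End CosetIndicators.

Theorem proposition5p2 (R : realType) (A : cstarAlgType R) (G : groupType)
    (alpha : G -> A -> A)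
    (A_neq0 : exists a : A, a <> 0%R)
    (G_countable : countable [set: G])
    (G_resfin : residually_finite G)
    (alpha_action : is_action alpha)
    (dim_finite : (Rokhlin_dim alpha < +oo)%E) :
  pointwise_outer alpha.
Proof.
move=> g g1 [u uu gE]; have [a a0] := A_neq0.
have [H Hfin gH] := G_resfin g g1.
have [N Nfin gN] := normal_core_free Hfin gH.
have [d /= dimN] := Rokhlin_dim_fin dim_finite Nfin.
(* [D] must contain [u.1] for [alpha g] to act trivially on [F(D, A)], and [a] for [F(D, A)] to be
   nonzero. *)
have [D [c [Dc Dsep Dinv aD bD]]] :=
  separable_invariant_subalg a u.1 G_countable alpha_action.
have Dcl : closed [set` D] by rewrite Dc; exact: closed_closure.
have [phi [phiP phi1]] := dimN D Dcl Dsep Dinv.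
apply: (central_seq_neq0 Dc aD a0).
suff -> : 0 = \sum_l phi l (cst 1) by [].
rewrite big1// => l _; have [_ _ phi0 phis] := phiP l.
have [s0 sE0] := (finite_seqP _).1 Nfin.
have sE : [set: lcosets N] = [set` undup s0].
  by rewrite sE0; apply/seteqP; split=> k /=; rewrite mem_undup.
rewrite (sum_coset_indicator R sE (undup_uniq _)) linear_sum big1_seq//= => k _.
apply: central_seq_star_mul_eq0.
(* Equivariance and triviality of the action identify the images of the two orthogonal indicators,
   so the image of one is orthogonal to itself. *)
have := phi0 _ _ (coset_indicator_orthogonal R (@gN k)).
rewrite -coset_shift_indicator phis (central_seq_map_inner _ uu gE bD).
by case.
Qed.
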